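(* Let $f$ be a complex-valued function satisfying: (a) $f(z)$ is analytic for $|z|<1$; (b) $|f(z)|<1$ for $|z|<1$; (c) $f(0)=0$; (d) for some $b\in\mathbb{C}$ with $|b|=1$, $f$ extends continuously to $b$, $|f(b)|=1$, and $f'(b)$ exists. Then $$|f'(b)|\geq \frac{2}{1+|f'(0)|}.$$
   Context: ''$f$ extends continuously to $b$'' means that $f(z)$ has a limit as $z\to b$ with $|z|<1$; this limit is denoted $f(b)$. ''$f'(b)$ exists'' means that the limit $f'(b)=\lim_{z\to b,\ |z|<1}\frac{f(z)-f(b)}{z-b}$ exists in $\mathbb{C}$. *)

(* Defs.v *)
From Stdlib Require Import Reals.
From Coquelicot Require Import Coquelicot.
Open Scope R_scope.

Definition unit_disc (z : C) : Prop := Cmod z < 1.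

(* [ex_derive] is taken over the field C, i.e. this is complex
   differentiability at every point of the (open) set D. *)
Definition analytic_in (D : C -> Prop) (f : C -> C) : Prop :=
  forall z : C, D z -> @ex_derive C_AbsRing C_NormedModule f z.

(* [fb] is the limit of f at b from inside the disc; it is unrelated to the
   value taken at b by the total function f. *)
Definition extends_continuously_to (f : C -> C) (b fb : C) : Prop :=
  filterlim f (within unit_disc (@locally C_UniformSpace b))
              (@locally C_UniformSpace fb).

(* [db] is f'(b), where [fb] is the boundary value of f at b. The quotient is
   always meaningful when |b| = 1, since then z <> b inside the disc. *)
Definition is_boundary_derivative (f : C -> C) (b fb db : C) : Prop :=
  filterlim (fun z : C => ((f z - fb) / (z - b))%C)
            (within unit_disc (@locally C_UniformSpace b))
            (@locally C_UniformSpace db).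

(* Main.v *)
Require Import Defs.
From Stdlib Require Import Reals Lra ClassicalEpsilon.
From Coquelicot Require Import Coquelicot.
Open Scope R_scope.

(* Goursat's bisection argument, applied in polar coordinates, shows that circle means of
   [Re k] about [0] do not depend on the radius. This survives isolated points where [k] is
   merely continuous, so it yields a minimum principle for [Re k (0)]. Applied to
   [p = 1 / (1 - c F)], [|c| = 1], which has [Re p >= 1/2], it gives a Harnack inequality
   involving [F'(0)], and choosing [c F(r) = |F(r)|] turns that into
   [1 - |F(r)| >= (1 - r^2) / (1 + r |F'(0)|)].
   With [F(z) = f(rho b z)], [1 - rho = (1 - r)^2] and [r -> 1], this bounds the difference
   quotient of [f] at [b] along the radius. *)

(** * Goursat's lemma for closed forms *)

(** Analyticity here is pointwise complex differentiability, with nothing known about continuity of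
    the derivative, so circle means cannot simply be differentiated in the radius under the integral
    sign; bisection takes the place of that step. The exceptional points come from the Harnack test
    function: it contains difference quotients of [p] centred at [0] and at [r], and at their
    centres only continuity is proved. The weight integrated against [Re p - 1/2] is
    [1 + r^2 + 2 r cos t], which picks out [p(0)] and [p'(0)], minus a multiple of the Poisson
    kernel, which picks out [p(r)]. The difference is [4 r^2 sin^2 t / |1 - r z|^2 >= 0], so a
    single linear inequality ties [p(r)] to [p'(0)]. The dilation [rho] is there because the circle
    [|z| = 1] must lie inside the domain, while [f] is controlled only in the open disc. Its defect
    is of second order in [1 - r], so [(1 - r^2) / (1 - rho r)] still tends to [2]. *)

Definition rect_int (P Q : R -> R -> R) (a b c d : R) : R :=
  RInt (fun x => P x c - P x d) a b + RInt (fun y => Q b y - Q a y) c d.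

Definition continuous_on_rect (F : R -> R -> R) (a b c d : R) : Prop :=
  forall x y, a <= x <= b -> c <= y <= d -> continuity_2d_pt F x y.

Lemma continuity_2d_pt_slice1 (F : R -> R -> R) (x y : R) :
  continuity_2d_pt F x y -> continuous (fun t => F t y) x.
Proof.
  intros H; apply continuity_pt_filterlim; apply continuity_pt_locally; intros eps.
  destruct (H eps) as [d Hd]; exists d; intros u Hu; apply Hd; [exact Hu|].
  rewrite Rminus_eq_0, Rabs_R0; apply cond_pos.
Qed.

Lemma continuity_2d_pt_slice2 (F : R -> R -> R) (x y : R) :
  continuity_2d_pt F x y -> continuous (F x) y.
Proof.
  intros H; apply continuity_pt_filterlim; apply continuity_pt_locally; intros eps.
  destruct (H eps) as [d Hd]; exists d; intros u Hu; apply Hd; [|exact Hu].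
  rewrite Rminus_eq_0, Rabs_R0; apply cond_pos.
Qed.

Lemma ex_RInt_slice1 (F : R -> R -> R) (a b c d x1 x2 y y' : R) :
  continuous_on_rect F a b c d -> a <= x1 <= x2 -> x2 <= b ->
  c <= y <= d -> c <= y' <= d -> ex_RInt (fun x => F x y - F x y') x1 x2.
Proof.
  intros H H1 H2 Hy Hy'; apply (@ex_RInt_minus R_NormedModule);
  apply (@ex_RInt_continuous R_CompleteNormedModule); intros z;
  rewrite Rmin_left, Rmax_right by lra; intros Hz;
  apply (continuity_2d_pt_slice1 F), H; lra.
Qed.

Lemma ex_RInt_slice2 (F : R -> R -> R) (a b c d x x' y1 y2 : R) :
  continuous_on_rect F a b c d -> c <= y1 <= y2 -> y2 <= d ->
  a <= x <= b -> a <= x' <= b -> ex_RInt (fun y => F x y - F x' y) y1 y2.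
Proof.
  intros H H1 H2 Hx Hx'; apply (@ex_RInt_minus R_NormedModule);
  apply (@ex_RInt_continuous R_CompleteNormedModule); intros z;
  rewrite Rmin_left, Rmax_right by lra; intros Hz;
  apply (continuity_2d_pt_slice2 F), H; lra.
Qed.

Lemma continuous_on_subrect (F : R -> R -> R) (a b c d a' b' c' d' : R) :
  continuous_on_rect F a b c d -> a <= a' -> b' <= b -> c <= c' -> d' <= d ->
  continuous_on_rect F a' b' c' d'.
Proof. intros H ? ? ? ? x y ? ?; apply H; lra. Qed.

Lemma RInt_Rplus (f g : R -> R) (a b : R) :
  ex_RInt f a b -> ex_RInt g a b ->
  RInt (fun x => f x + g x) a b = RInt f a b + RInt g a b.
Proof. exact (@RInt_plus R_CompleteNormedModule f g a b). Qed.

(** The two circulations run along the common side [x = m] in opposite directions. *)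
Lemma rect_int_split1 (P Q : R -> R -> R) (a m b c d : R) :
  continuous_on_rect P a b c d -> continuous_on_rect Q a b c d ->
  a <= m <= b -> c <= d ->
  rect_int P Q a b c d = rect_int P Q a m c d + rect_int P Q m b c d.
Proof.
  intros HP HQ Hm Hcd; unfold rect_int.
  rewrite <- (RInt_Chasles (fun x => P x c - P x d) a m b)
    by (apply (ex_RInt_slice1 P a b c d); auto; lra).
  replace (RInt (fun y => Q b y - Q a y) c d)
    with (RInt (fun y => (Q b y - Q m y) + (Q m y - Q a y)) c d)
    by (apply RInt_ext; intros; simpl; ring).
  rewrite RInt_Rplus by (apply (ex_RInt_slice2 Q a b c d); auto; lra).
  unfold plus; simpl; ring.
Qed.

Lemma rect_int_split2 (P Q : R -> R -> R) (a b c m d : R) :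
  continuous_on_rect P a b c d -> continuous_on_rect Q a b c d ->
  a <= b -> c <= m <= d ->
  rect_int P Q a b c d = rect_int P Q a b c m + rect_int P Q a b m d.
Proof.
  intros HP HQ Hab Hm; unfold rect_int.
  rewrite <- (RInt_Chasles (fun y => Q b y - Q a y) c m d)
    by (apply (ex_RInt_slice2 Q a b c d); auto; lra).
  replace (RInt (fun x => P x c - P x d) a b)
    with (RInt (fun x => (P x c - P x m) + (P x m - P x d)) a b)
    by (apply RInt_ext; intros; simpl; ring).
  rewrite RInt_Rplus by (apply (ex_RInt_slice1 P a b c d); auto; lra).
  unfold plus; simpl; ring.
Qed.

Lemma RInt_near_const (f : R -> R) (a b l M : R) :
  a <= b -> ex_RInt f a b ->
  (forall t, a <= t <= b -> Rabs (f t - l) <= M) ->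
  Rabs (RInt f a b - l * (b - a)) <= (b - a) * M.
Proof.
  intros Hab Hf HM.
  replace (RInt f a b - l * (b - a)) with (RInt (fun t => minus (f t) l) a b).
  - apply abs_RInt_le_const; auto.
    apply (@ex_RInt_minus R_NormedModule); auto; apply ex_RInt_const.
  - rewrite (@RInt_minus R_CompleteNormedModule); auto using ex_RInt_const.
    rewrite RInt_const; unfold minus, plus, opp, scal; simpl; unfold mult; simpl; ring.
Qed.

(** The shared [l] is both the [y]-derivative of [P] and the [x]-derivative of [Q]: the form
    [P dx + Q dy] is closed at one point, with total differentiability there and no continuity of
    the partial derivatives. [rect_int] is its counterclockwise circulation. *)
Definition closed_at (P Q : R -> R -> R) (x y : R) : Prop :=
  exists m l n, differentiable_pt_lim P x y m l /\ differentiable_pt_lim Q x y l n.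

Definition closed_on_rect (P Q : R -> R -> R) (a b c d : R) : Prop :=
  forall x y, a <= x <= b -> c <= y <= d -> closed_at P Q x y.

Lemma closed_on_rect_continuous (P Q : R -> R -> R) (a b c d : R) :
  closed_on_rect P Q a b c d ->
  continuous_on_rect P a b c d /\ continuous_on_rect Q a b c d.
Proof.
  intros H; split; intros x y Hx Hy; apply differentiable_continuity_pt;
  destruct (H x y Hx Hy) as (m & l & n & HP & HQ); [exists m, l | exists l, n]; auto.
Qed.

(** The linear parts leave [l (c - d) (b - a)] from the horizontal pair of sides and
    [l (b - a) (d - c)] from the vertical pair; these cancel because [l] is shared. What remains is
    the differentiability error, [eps / 2] times the size for each side of a pair. *)
Lemma rect_int_small (P Q : R -> R -> R) (u v eps : R) :
  closed_at P Q u v -> 0 < eps ->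
  exists delta : posreal, forall a b c d,
    a <= u <= b -> c <= v <= d -> b - a < delta -> d - c < delta ->
    continuous_on_rect P a b c d -> continuous_on_rect Q a b c d ->
    Rabs (rect_int P Q a b c d) <= eps * ((b - a) + (d - c)) ^ 2.
Proof.
  intros (m & l & n & HP & HQ) Heps.
  assert (He : 0 < eps / 2) by lra.
  destruct (HP (mkposreal _ He)) as [d1 H1]; destruct (HQ (mkposreal _ He)) as [d2 H2].
  simpl in H1, H2.
  exists (mkposreal _ (Rmin_stable_in_posreal d1 d2)); cbn [pos].
  intros a b c d Hu Hv Hba Hdc CP CQ.
  assert (E1 := Rmin_l d1 d2); assert (E2 := Rmin_r d1 d2).
  set (D := (b - a) + (d - c)).
  assert (near : forall x y, a <= x <= b -> c <= y <= d ->
    Rabs (x - u) < Rmin d1 d2 /\ Rabs (y - v) < Rmin d1 d2 /\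
    eps / 2 * Rmax (Rabs (x - u)) (Rabs (y - v)) <= eps / 2 * D).
  { intros x y Hx Hy; repeat split; try (apply Rabs_def1; lra).
    apply Rmult_le_compat_l; [lra|]; apply Rmax_lub; apply Rabs_le; unfold D; lra. }
  assert (BP : Rabs (RInt (fun x => P x c - P x d) a b - (l * (c - d)) * (b - a))
    <= (b - a) * (eps * D)).
  { apply RInt_near_const; [lra| apply (ex_RInt_slice1 P a b c d); auto; lra|].
    intros t Ht.
    destruct (near t c Ht) as (A1 & A2 & A3); [lra|].
    destruct (near t d Ht) as (B1 & B2 & B3); [lra|].
    assert (A := H1 t c ltac:(lra) ltac:(lra)); assert (B := H1 t d ltac:(lra) ltac:(lra)).
    apply Rabs_le_between in A; apply Rabs_le_between in B; apply Rabs_le; lra. }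
  assert (BQ : Rabs (RInt (fun y => Q b y - Q a y) c d - (l * (b - a)) * (d - c))
    <= (d - c) * (eps * D)).
  { apply RInt_near_const; [lra| apply (ex_RInt_slice2 Q a b c d); auto; lra|].
    intros t Ht.
    destruct (near a t) as (A1 & A2 & A3); [lra|lra|].
    destruct (near b t) as (B1 & B2 & B3); [lra|lra|].
    assert (A := H2 a t ltac:(lra) ltac:(lra)); assert (B := H2 b t ltac:(lra) ltac:(lra)).
    apply Rabs_le_between in A; apply Rabs_le_between in B; apply Rabs_le; lra. }
  apply Rabs_le_between in BP; apply Rabs_le_between in BQ; unfold rect_int.
  replace (eps * D ^ 2) with ((b - a) * (eps * D) + (d - c) * (eps * D)) by (unfold D; ring).
  apply Rabs_le; lra.
Qed.

Lemma nested_intervals (x y : nat -> R) :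
  (forall n, x n <= x (S n)) -> (forall n, y (S n) <= y n) -> (forall n, x n <= y n) ->
  exists z, forall n, x n <= z <= y n.
Proof.
  intros Hx Hy Hxy.
  assert (Mx : forall n k, x n <= x (n + k)%nat).
  { intros n k; induction k as [|k IH]; [rewrite Nat.add_0_r; lra|].
    rewrite Nat.add_succ_r; eapply Rle_trans; [exact IH | apply Hx]. }
  assert (My : forall n k, y (n + k)%nat <= y n).
  { intros n k; induction k as [|k IH]; [rewrite Nat.add_0_r; lra|].
    rewrite Nat.add_succ_r; eapply Rle_trans; [apply Hy | exact IH]. }
  assert (ub : forall n, is_upper_bound (fun t => exists m, t = x m) (y n)).
  { intros n t [m ->]; apply Rle_trans with (x (n + m)%nat).
    - rewrite Nat.add_comm; apply Mx.
    - eapply Rle_trans; [apply Hxy | apply My]. }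
  destruct (completeness (fun t => exists m, t = x m)) as [z [Hz1 Hz2]].
  - exists (y O); apply ub.
  - exists (x O), O; reflexivity.
  - exists z; intros n; split; [apply Hz1; exists n; reflexivity | apply Hz2, ub].
Qed.

Lemma rect_int_closed (P Q : R -> R -> R) (a c w h : R) :
  0 <= w -> 0 <= h -> closed_on_rect P Q a (a + w) c (c + h) ->
  rect_int P Q a (a + w) c (c + h) = 0.
Proof.
  intros Hw Hh Hcl.
  destruct (closed_on_rect_continuous P Q _ _ _ _ Hcl) as [CP CQ].
  set (I := fun n x y => rect_int P Q x (x + w / 2 ^ n) y (y + h / 2 ^ n)).
  set (inside := fun n x y =>
    a <= x /\ x + w / 2 ^ n <= a + w /\ c <= y /\ y + h / 2 ^ n <= c + h).
  (* The threshold is quadratic in the size, so halving both sides divides it by four: if a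
     rectangle exceeds it, so does one of its quarters. *)
  set (bad := fun eps n x y => eps * (w / 2 ^ n + h / 2 ^ n) ^ 2 < Rabs (I n x y)).
  assert (P2 : forall n, 0 < / 2 ^ n) by (intros; apply Rinv_0_lt_compat, pow_lt; lra).
  assert (pos : forall n, 0 <= w / 2 ^ n /\ 0 <= h / 2 ^ n).
  { intros n; split; apply Rmult_le_pos; auto; apply Rlt_le, P2. }
  assert (half : forall n t, t / 2 ^ n = t / 2 ^ S n + t / 2 ^ S n).
  { intros n t; simpl; field; apply pow_nonzero; lra. }
  assert (quarter : forall eps n x y, inside n x y -> bad eps n x y ->
    exists x' y', bad eps (S n) x' y' /\ inside (S n) x' y' /\
      x <= x' /\ x' + w / 2 ^ S n <= x + w / 2 ^ n /\
      y <= y' /\ y' + h / 2 ^ S n <= y + h / 2 ^ n).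
  { intros eps n x y (I1 & I2 & I3 & I4) B.
    assert (Ew := half n w); assert (Eh := half n h); destruct (pos (S n)) as [pw ph].
    set (w' := w / 2 ^ S n) in *; set (h' := h / 2 ^ S n) in *.
    assert (CP' : continuous_on_rect P x (x + w / 2 ^ n) y (y + h / 2 ^ n))
      by (apply (continuous_on_subrect P a (a + w) c (c + h)); auto).
    assert (CQ' : continuous_on_rect Q x (x + w / 2 ^ n) y (y + h / 2 ^ n))
      by (apply (continuous_on_subrect Q a (a + w) c (c + h)); auto).
    assert (S4 : I n x y = I (S n) x y + I (S n) x (y + h')
      + (I (S n) (x + w') y + I (S n) (x + w') (y + h'))).
    { unfold I; fold w'; fold h'.
      rewrite (rect_int_split1 P Q x (x + w')) by (auto; lra).
      rewrite (rect_int_split2 P Q x (x + w') y (y + h'))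
        by (try (eapply continuous_on_subrect; [eassumption | lra ..]); lra).
      rewrite (rect_int_split2 P Q (x + w') _ y (y + h'))
        by (try (eapply continuous_on_subrect; [eassumption | lra ..]); lra).
      replace (x + w' + w') with (x + w / 2 ^ n) by lra.
      replace (y + h' + h') with (y + h / 2 ^ n) by lra.
      reflexivity. }
    assert (T4 : Rabs (I n x y) <= Rabs (I (S n) x y) + Rabs (I (S n) x (y + h'))
      + (Rabs (I (S n) (x + w') y) + Rabs (I (S n) (x + w') (y + h')))).
    { rewrite S4; eapply Rle_trans; [apply Rabs_triang|].
      apply Rplus_le_compat; apply Rabs_triang. }
    unfold bad in B.
    replace (eps * (w / 2 ^ n + h / 2 ^ n) ^ 2) with (4 * (eps * (w' + h') ^ 2)) in B
      by (rewrite Ew, Eh; ring).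
    unfold bad; fold w' h'; unfold inside; fold w' h'.
    destruct (Rlt_le_dec (eps * (w' + h') ^ 2) (Rabs (I (S n) x y)));
      [exists x, y; repeat split; auto; lra|].
    destruct (Rlt_le_dec (eps * (w' + h') ^ 2) (Rabs (I (S n) x (y + h'))));
      [exists x, (y + h'); repeat split; auto; lra|].
    destruct (Rlt_le_dec (eps * (w' + h') ^ 2) (Rabs (I (S n) (x + w') y)));
      [exists (x + w'), y; repeat split; auto; lra|].
    exists (x + w'), (y + h'); repeat split; auto; lra. }
  assert (main : forall eps, 0 < eps -> ~ bad eps O a c).
  { intros eps Heps B0.
    (* The state carries its own level along with the corner, so that the invariants at that scale
       fit in one sigma type. Indefinite description turns the existence of a bad quarter into a
       function that can be iterated. *)
    assert (step : forall s : {t : nat * (R * R) |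
        inside (fst t) (fst (snd t)) (snd (snd t)) /\
        bad eps (fst t) (fst (snd t)) (snd (snd t))},
      {s' : {t : nat * (R * R) |
        inside (fst t) (fst (snd t)) (snd (snd t)) /\
        bad eps (fst t) (fst (snd t)) (snd (snd t))} |
        let '(n, (x, y)) := proj1_sig s in let '(n', (x', y')) := proj1_sig s' in
        n' = S n /\ x <= x' /\ x' + w / 2 ^ S n <= x + w / 2 ^ n /\
        y <= y' /\ y' + h / 2 ^ S n <= y + h / 2 ^ n}).
    { intros [[n [x y]] [Hi Hb]]; simpl in *.
      apply constructive_indefinite_description.
      destruct (quarter eps n x y Hi Hb) as (x' & y' & Hb' & Hi' & H).
      exists (exist _ (S n, (x', y')) (conj Hi' Hb')); simpl; auto. }
    assert (Hi0 : inside O a c) by (unfold inside; simpl; lra).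
    set (seq := fix seq n := match n with
      | O => exist _ (O, (a, c)) (conj Hi0 B0)
      | S n => proj1_sig (step (seq n)) end).
    set (X := fun n => fst (snd (proj1_sig (seq n)))).
    set (Y := fun n => snd (snd (proj1_sig (seq n)))).
    assert (idx : forall n, fst (proj1_sig (seq n)) = n /\
      X n <= X (S n) /\ X (S n) + w / 2 ^ S n <= X n + w / 2 ^ n /\
      Y n <= Y (S n) /\ Y (S n) + h / 2 ^ S n <= Y n + h / 2 ^ n).
    { assert (E : forall n, fst (proj1_sig (seq n)) = n).
      { induction n as [|n IH]; [reflexivity|]; simpl.
        destruct (step (seq n)) as [[[n' [x' y']] Hs'] Hrel]; simpl in *.
        destruct (seq n) as [[m [x y]] Hs]; simpl in *; subst; tauto. }
      intros n; split; [apply E|]; generalize (E n); unfold X, Y; simpl.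
      destruct (step (seq n)) as [[[n' [x' y']] Hs'] Hrel]; simpl in *.
      destruct (seq n) as [[m [x y]] Hs]; simpl in *; intros ->; tauto. }
    assert (Hbad : forall n, inside n (X n) (Y n) /\ bad eps n (X n) (Y n)).
    { intros n; destruct (idx n) as [E _]; unfold X, Y.
      (* Only the scale arguments of [inside] and [bad] are rewritten, not the [n] under [seq]. *)
      rewrite <- E at 1 4; exact (proj2_sig (seq n)). }
    destruct (nested_intervals X (fun n => X n + w / 2 ^ n)) as [u Hu];
      [intros n; apply (idx n)| intros n; apply (idx n)| intros n; destruct (pos n); lra|].
    destruct (nested_intervals Y (fun n => Y n + h / 2 ^ n)) as [v Hv];
      [intros n; apply (idx n)| intros n; apply (idx n)| intros n; destruct (pos n); lra|].
    destruct (rect_int_small P Q u v eps) as [delta Hd]; [|exact Heps|].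
    { generalize (Hu O) (Hv O); unfold X, Y; simpl; intros; apply Hcl; lra. }
    (* The [+ 1] keeps the divisor positive for a degenerate rectangle. *)
    destruct (pow_lt_1_zero (1 / 2) ltac:(rewrite Rabs_pos_eq; lra) (delta / (w + h + 1)))
      as [n Hn].
    { apply Rdiv_lt_0_compat; [apply cond_pos|lra]. }
    specialize (Hn n (le_n n)).
    assert (Esize : (w + h + 1) / 2 ^ n < delta).
    { apply Rmult_lt_reg_r with (/ (w + h + 1)); [apply Rinv_0_lt_compat; lra|].
      replace ((w + h + 1) / 2 ^ n * / (w + h + 1)) with ((1 / 2) ^ n);
      [rewrite Rabs_pos_eq in Hn; [exact Hn| apply pow_le; lra]|].
      unfold Rdiv; rewrite Rmult_1_l, pow_inv; field.
      split; [lra| apply pow_nonzero; lra]. }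
    replace ((w + h + 1) / 2 ^ n) with (w / 2 ^ n + h / 2 ^ n + / 2 ^ n) in Esize
      by (unfold Rdiv; ring).
    destruct (Hbad n) as [(I1 & I2 & I3 & I4) Hb]; destruct (pos n); specialize (P2 n).
    specialize (Hu n); specialize (Hv n); simpl in Hu, Hv.
    refine (Rlt_not_le _ _ Hb _); unfold I.
    replace (w / 2 ^ n + h / 2 ^ n)
      with ((X n + w / 2 ^ n - X n) + (Y n + h / 2 ^ n - Y n)) by ring.
    apply Hd; try lra; eapply continuous_on_subrect; eassumption. }
  destruct (Req_dec (rect_int P Q a (a + w) c (c + h)) 0) as [E|E]; [exact E|exfalso].
  assert (E' := Rabs_pos_lt _ E).
  assert (S1 : 0 < (w + h) ^ 2 + 1) by (generalize (pow2_ge_0 (w + h)); lra).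
  (* With this [eps] the threshold is the absolute circulation times [(w + h)^2 / ((w + h)^2 + 1)],
     strictly below the circulation itself, so the initial rectangle is bad. *)
  apply (main (Rabs (rect_int P Q a (a + w) c (c + h)) / ((w + h) ^ 2 + 1)));
    [apply Rdiv_lt_0_compat; lra|].
  unfold bad, I; simpl (2 ^ 0); rewrite !Rdiv_1_r.
  apply Rmult_lt_reg_r with ((w + h) ^ 2 + 1); [lra|].
  unfold Rdiv; set (K := Rabs _) in *; field_simplify; [nra|lra].
Qed.

(** * Circle means *)

(** Domain and codomain carry the same structure, that of the ring with the [Cmod] metric; the
    product and chain rules apply in this form. *)
Notation ex_Cderive f z :=
  (@ex_derive C_AbsRing (AbsRing_NormedModule C_AbsRing) f z).
Notation is_Cderive f z l :=
  (@is_derive C_AbsRing (AbsRing_NormedModule C_AbsRing) f z l).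
Notation Ccontinuous f z :=
  (@continuous (AbsRing_UniformSpace C_AbsRing) (AbsRing_UniformSpace C_AbsRing) f z).

Lemma is_Cderive_iff (f : C -> C) (z l : C) :
  is_Cderive f z l <->
  forall eps : posreal, exists delta : posreal, forall w,
    Cmod (w - z) < delta -> Cmod (f w - f z - (w - z) * l) <= eps * Cmod (w - z).
Proof.
  split.
  - intros [_ H] eps; exact (H z (fun P HP => HP) eps).
  - intros H; split.
    + apply is_linear_scal_l.
    + intros x Hx.
      apply (@is_filter_lim_locally_unique C_AbsRing (AbsRing_NormedModule C_AbsRing)) in Hx.
      subst x; exact H.
Qed.

Lemma Ccontinuous_iff (f : C -> C) (z : C) :
  Ccontinuous f z <->
  forall eps : posreal, exists delta : posreal, forall w,
    Cmod (w - z) < delta -> Cmod (f w - f z) < eps.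
Proof.
  split.
  - intros H; exact (proj1 (filterlim_locally _ _) H).
  - intros H; exact (proj2 (filterlim_locally _ _) H).
Qed.

Lemma Cmod_le_2Rmax (x y : R) : Cmod (x, y) <= 2 * Rmax (Rabs x) (Rabs y).
Proof.
  eapply Rle_trans; [apply Cmod_2Rmax|]; apply Rmult_le_compat_r.
  - eapply Rle_trans; [apply Rabs_pos | apply Rmax_l].
  - rewrite <- (sqrt_Rsqr 2) at 2 by lra; apply sqrt_le_1_alt; unfold Rsqr; lra.
Qed.

Lemma im_le_Cmod (z : C) : Rabs (Im z) <= Cmod z.
Proof. eapply Rle_trans; [apply Rmax_r | apply Rmax_Cmod]. Qed.

(** The Cauchy-Riemann equations: multiplication by [l] is a real linear map, and its matrix entries
    are the partial derivatives. *)
Lemma is_Cderive_differentiable (f : C -> C) (x y : R) (l : C) :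
  is_Cderive f (x, y) l ->
  differentiable_pt_lim (fun u v => Re (f (u, v))) x y (Re l) (- Im l) /\
  differentiable_pt_lim (fun u v => Im (f (u, v))) x y (Im l) (Re l).
Proof.
  intros H; rewrite is_Cderive_iff in H.
  assert (key : forall eps : posreal, exists delta : posreal, forall u v,
    Rabs (u - x) < delta -> Rabs (v - y) < delta ->
    Cmod (f (u, v) - f (x, y) - (u - x, v - y) * l)
      <= eps * Rmax (Rabs (u - x)) (Rabs (v - y))).
  { intros eps.
    (* Halving [eps] and, below, [d] absorbs the factor [2] between [Cmod] and the maximum norm. *)
    assert (E2 : 0 < eps / 2) by (generalize (cond_pos eps); lra).
    destruct (H (mkposreal _ E2)) as [d Hd]; cbn [pos] in Hd.
    assert (D2 : 0 < d / 2) by (generalize (cond_pos d); lra).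
    exists (mkposreal _ D2); cbn [pos]; intros u v Hu Hv.
    assert (B := Cmod_le_2Rmax (u - x) (v - y)).
    assert (L : Rmax (Rabs (u - x)) (Rabs (v - y)) < d / 2) by (apply Rmax_lub_lt; auto).
    change (u - x, v - y) with ((u, v) - (x, y))%C in *.
    eapply Rle_trans; [apply Hd; lra|].
    replace (eps * Rmax (Rabs (u - x)) (Rabs (v - y)))
      with (eps / 2 * (2 * Rmax (Rabs (u - x)) (Rabs (v - y)))) by field.
    apply Rmult_le_compat_l; lra. }
  split; intros eps; destruct (key eps) as [d Hd]; exists d; intros u v Hu Hv;
    (eapply Rle_trans; [|apply (Hd u v Hu Hv)]).
  - eapply Rle_trans; [|apply re_le_Cmod]; right; f_equal.
    unfold Cminus; rewrite !re_plus, !re_opp, re_mult; simpl; ring.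
  - eapply Rle_trans; [|apply im_le_Cmod]; right; f_equal.
    unfold Cminus, Re, Im; simpl; ring.
Qed.

Lemma differentiable_pt_lim_mult (x y : R) : differentiable_pt_lim Rmult x y y x.
Proof.
  intros eps; exists eps; intros u v Hu Hv.
  replace (u * v - x * y - (y * (u - x) + x * (v - y))) with ((u - x) * (v - y)) by ring.
  rewrite Rabs_mult; apply Rmult_le_compat; try apply Rabs_pos; [lra | apply Rmax_r].
Qed.

Lemma differentiable_pt_lim_proj2_0 (g : R -> R) (x y l : R) :
  derivable_pt_lim g y l -> differentiable_pt_lim (fun _ v => g v) x y 0 l.
Proof.
  intros H eps.
  apply is_derive_Reals in H; destruct H as [_ H].
  destruct (H y (fun P HP => HP) eps) as [d Hd]; exists d; intros u v _ Hv.
  specialize (Hd v Hv); unfold norm, minus, plus, opp, scal in Hd; simpl in Hd.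
  unfold abs, mult in Hd; simpl in Hd.
  replace (g v - g y - (0 * (u - x) + l * (v - y)))
    with (g v + - g y + - ((v + - y) * l)) by ring.
  eapply Rle_trans; [exact Hd|]; apply Rmult_le_compat_l; [apply Rlt_le, cond_pos|apply Rmax_r].
Qed.

Definition polar (r t : R) : C := (r * cos t, r * sin t).

Lemma Cmod_polar (r t : R) : Cmod (polar r t) = Rabs r.
Proof.
  unfold Cmod, polar; simpl.
  replace (r * cos t * (r * cos t * 1) + r * sin t * (r * sin t * 1)) with (Rsqr r).
  - apply sqrt_Rsqr_abs.
  - generalize (sin2_cos2 t); unfold Rsqr; intros E.
    transitivity (r * r * (sin t * sin t + cos t * cos t)); [rewrite E; ring | ring].
Qed.

Lemma differentiable_pt_lim_polar (f : R -> R -> R) (r t lx ly : R) :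
  differentiable_pt_lim f (r * cos t) (r * sin t) lx ly ->
  differentiable_pt_lim (fun u v => f (u * cos v) (u * sin v)) r t
    (lx * cos t + ly * sin t) (lx * (- r * sin t) + ly * (r * cos t)).
Proof.
  intros H.
  assert (Hr : differentiable_pt_lim (fun u _ : R => u) r t 1 0)
    by (apply differentiable_pt_lim_proj1_0, derivable_pt_lim_id).
  assert (Hc := differentiable_pt_lim_proj2_0 cos r t _ (derivable_pt_lim_cos t)).
  assert (Hs := differentiable_pt_lim_proj2_0 sin r t _ (derivable_pt_lim_sin t)).
  assert (HX := differentiable_pt_lim_comp _ _ _ _ _ _ _ _ _ _ _
    (differentiable_pt_lim_mult r (cos t)) Hr Hc).
  assert (HY := differentiable_pt_lim_comp _ _ _ _ _ _ _ _ _ _ _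
    (differentiable_pt_lim_mult r (sin t)) Hr Hs).
  assert (HF := differentiable_pt_lim_comp _ _ _ _ _ _ _ _ _ _ _ H HX HY).
  match type of HF with differentiable_pt_lim _ _ _ ?a ?b =>
    replace (lx * cos t + ly * sin t) with a by ring;
    replace (lx * (- r * sin t) + ly * (r * cos t)) with b by ring end.
  exact HF.
Qed.

(* In polar coordinates [Im (k dz / z)] is the form [Im k / r dr + Re k dt]. *)
Lemma polar_form_closed (k : C -> C) (r t : R) :
  0 < r -> ex_Cderive k (polar r t) ->
  closed_at (fun u v => Im (k (polar u v)) / u) (fun u v => Re (k (polar u v))) r t.
Proof.
  intros Hr [l Hl].
  destruct (is_Cderive_differentiable _ _ _ _ Hl) as [HRe HIm].
  apply differentiable_pt_lim_polar in HRe; apply differentiable_pt_lim_polar in HIm.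
  assert (Hinv : differentiable_pt_lim (fun u _ : R => / u) r t (- / r ^ 2) 0).
  { apply differentiable_pt_lim_proj1_0, is_derive_Reals.
    auto_derive; [lra | field; lra]. }
  assert (HP := differentiable_pt_lim_comp _ _ _ _ _ _ _ _ _ _ _
    (differentiable_pt_lim_mult _ _) HIm Hinv).
  cbv beta in HP; eexists _, _, _; split; [exact HP|].
  match type of HP with differentiable_pt_lim _ _ _ _ ?b =>
    replace b with (Re l * cos t + - Im l * sin t) by (field; lra) end.
  exact HRe.
Qed.

Definition circle_integral (k : C -> C) (r : R) : R :=
  RInt (fun t => Re (k (polar r t))) 0 (2 * PI).

(** The closed form is integrated around the rectangle [[a, b] x [0, 2 PI]] of the polar plane. The
    sides [t = 0] and [t = 2 PI] map to the same segment and cancel; the other two sides are the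
    circle integrals. *)
Lemma circle_integral_annulus (k : C -> C) (a b : R) :
  0 < a <= b -> (forall z, a <= Cmod z <= b -> ex_Cderive k z) ->
  circle_integral k b = circle_integral k a.
Proof.
  intros Hab Hk.
  assert (Hpi := PI_RGT_0).
  set (P := fun u v => Im (k (polar u v)) / u); set (Q := fun u v => Re (k (polar u v))).
  assert (Hcl : closed_on_rect P Q a (a + (b - a)) 0 (0 + 2 * PI)).
  { intros u v Hu Hv; apply polar_form_closed; [lra|].
    apply Hk; rewrite Cmod_polar, Rabs_pos_eq by lra; lra. }
  assert (H0 := rect_int_closed P Q a 0 (b - a) (2 * PI) ltac:(lra) ltac:(lra) Hcl).
  apply closed_on_rect_continuous in Hcl; destruct Hcl as [_ HQ].
  assert (ex : forall x, a <= x <= b -> ex_RInt (Q x) 0 (2 * PI)).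
  { intros x Hx; apply (@ex_RInt_continuous R_CompleteNormedModule); intros v.
    rewrite Rmin_left, Rmax_right by lra; intros Hv.
    apply continuity_2d_pt_slice2, HQ; lra. }
  unfold rect_int in H0.
  rewrite (RInt_ext _ (fun _ => 0)), RInt_const in H0.
  - replace (a + (b - a)) with b in H0 by ring; rewrite Rplus_0_l in H0.
    assert (E := @RInt_minus R_CompleteNormedModule (Q b) (Q a) 0 (2 * PI)
      (ex b ltac:(lra)) (ex a ltac:(lra))).
    unfold circle_integral; fold (Q a) (Q b).
    unfold minus, plus, opp, scal in *; simpl in *; unfold mult in *; simpl in *.
    unfold Rminus in H0. lra.
  - intros x _; unfold P, polar; simpl.
    rewrite Rplus_0_l, cos_2PI, sin_2PI, cos_0, sin_0; apply Rminus_eq_0.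
Qed.

Lemma Ccontinuous_polar (k : C -> C) (r t : R) :
  Ccontinuous k (polar r t) -> continuity_2d_pt (fun u v => Re (k (polar u v))) r t.
Proof.
  intros Hk eps; rewrite Ccontinuous_iff in Hk; destruct (Hk eps) as [d Hd].
  assert (D2 : 0 < d / 2) by (generalize (cond_pos d); lra).
  assert (HX : continuity_2d_pt (fun u v => u * cos v) r t).
  { apply continuity_2d_pt_mult; [apply continuity_2d_pt_id1|].
    apply (continuity_1d_2d_pt_comp cos); [apply continuity_cos | apply continuity_2d_pt_id2]. }
  assert (HY : continuity_2d_pt (fun u v => u * sin v) r t).
  { apply continuity_2d_pt_mult; [apply continuity_2d_pt_id1|].
    apply (continuity_1d_2d_pt_comp sin); [apply continuity_sin | apply continuity_2d_pt_id2]. }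
  destruct (HX (mkposreal _ D2)) as [d1 H1]; destruct (HY (mkposreal _ D2)) as [d2 H2].
  cbn [pos] in H1, H2.
  exists (mkposreal _ (Rmin_stable_in_posreal d1 d2)); cbn [pos]; intros u v Hu Hv.
  assert (E1 := Rmin_l d1 d2); assert (E2 := Rmin_r d1 d2).
  assert (Hnear : Cmod (polar u v - polar r t) < d).
  { eapply Rle_lt_trans; [apply Cmod_le_2Rmax|].
    assert (L := Rmax_lub_lt _ _ _ (H1 u v ltac:(lra) ltac:(lra)) (H2 u v ltac:(lra) ltac:(lra))).
    unfold Rminus in L; cbn [fst snd polar Copp] in *; lra. }
  eapply Rle_lt_trans; [|apply (Hd _ Hnear)].
  eapply Rle_trans; [|apply re_le_Cmod].
  unfold Cminus; rewrite re_plus, re_opp; right; reflexivity.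
Qed.

Lemma ex_circle_integral (k : C -> C) (r : R) :
  (forall z, Cmod z = Rabs r -> Ccontinuous k z) ->
  ex_RInt (fun t => Re (k (polar r t))) 0 (2 * PI).
Proof.
  intros Hk; apply (@ex_RInt_continuous R_CompleteNormedModule); intros t _.
  apply (continuity_2d_pt_slice2 (fun u v => Re (k (polar u v)))).
  apply Ccontinuous_polar, Hk, Cmod_polar.
Qed.

(** The integrand is uniformly continuous near the compact segment of angles at radius [r]. Since
    [polar] accepts negative radii, continuity at [r = 0] is two-sided like everywhere else. *)
Lemma circle_integral_continuous (k : C -> C) (R0 r : R) :
  (forall z, Cmod z < R0 -> Ccontinuous k z) -> Rabs r < R0 ->
  continuity_pt (circle_integral k) r.
Proof.
  intros Hk Hr; apply continuity_pt_locally; intros eps.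
  assert (Hpi := PI_RGT_0).
  assert (E : 0 < eps / (2 * PI + 1)) by (apply Rdiv_lt_0_compat; [apply cond_pos|lra]).
  destruct (uniform_continuity_2d_1d' (fun u v => Re (k (polar u v))) 0 (2 * PI) r)
    with (eps := mkposreal _ E) as [d Hd].
  { intros t _; apply Ccontinuous_polar, Hk; rewrite Cmod_polar; exact Hr. }
  cbn [pos] in Hd.
  assert (E' : 0 < Rmin d (R0 - Rabs r)) by (apply Rmin_pos; [apply cond_pos|lra]).
  exists (mkposreal _ E'); intros u Hu.
  change (Rabs (u - r) < Rmin d (R0 - Rabs r)) in Hu.
  assert (E1 := Rmin_l d (R0 - Rabs r)); assert (E2 := Rmin_r d (R0 - Rabs r)).
  assert (Hu' : Rabs u < R0) by (assert (T := Rabs_triang_inv u r); lra).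
  assert (exu : ex_RInt (fun t => Re (k (polar u t))) 0 (2 * PI))
    by (apply ex_circle_integral; intros z Hz; apply Hk; lra).
  assert (exr : ex_RInt (fun t => Re (k (polar r t))) 0 (2 * PI))
    by (apply ex_circle_integral; intros z Hz; apply Hk; lra).
  unfold circle_integral.
  assert (S := @RInt_minus R_CompleteNormedModule _ _ _ _ exu exr).
  unfold minus at 2, plus, opp in S; simpl in S; unfold Rminus; rewrite <- S.
  apply Rle_lt_trans with ((2 * PI - 0) * (eps / (2 * PI + 1))).
  - apply abs_RInt_le_const; [lra | apply (@ex_RInt_minus R_NormedModule); assumption |].
    intros t Ht; apply Rlt_le.
    apply Rabs_def2 in Hu; generalize (cond_pos d); intros Hdpos.
    apply (Hd t r t u); try lra.
    rewrite Rminus_eq_0, Rabs_R0; exact Hdpos.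
  - replace ((2 * PI - 0) * (eps / (2 * PI + 1))) with (eps * (2 * PI / (2 * PI + 1)))
      by (field; lra).
    rewrite <- (Rmult_1_r eps) at 2; apply Rmult_lt_compat_l; [apply cond_pos|].
    apply Rlt_div_l; lra.
Qed.

(** The integral is locally constant at radii strictly between [a] and [b], so its derivative
    vanishes there. Continuity carries the conclusion to the end radii, where [k] may fail to be
    differentiable and where [a] may be [0]. *)
Lemma circle_integral_shell (k : C -> C) (R0 a b : R) :
  0 <= a <= b -> b < R0 ->
  (forall z, Cmod z < R0 -> Ccontinuous k z) ->
  (forall z, a < Cmod z < b -> ex_Cderive k z) ->
  circle_integral k b = circle_integral k a.
Proof.
  intros Hab Hb Hc Hk.
  destruct (MVT_gen (circle_integral k) a b (fun _ => 0)) as (c & _ & Hc').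
  - rewrite Rmin_left, Rmax_right by lra; intros x Hx.
    apply (is_derive_ext_loc (fun _ => circle_integral k x));
      [|apply (@is_derive_const R_AbsRing R_NormedModule)].
    assert (E : 0 < Rmin (x - a) (b - x)) by (apply Rmin_pos; lra).
    exists (mkposreal _ E); intros u Hu.
    change (Rabs (u - x) < Rmin (x - a) (b - x)) in Hu.
    assert (E1 := Rmin_l (x - a) (b - x)); assert (E2 := Rmin_r (x - a) (b - x)).
    apply Rabs_def2 in Hu.
    destruct (Rle_dec u x).
    + apply circle_integral_annulus; [lra|]; intros z Hz; apply Hk; lra.
    + symmetry; apply circle_integral_annulus; [lra|]; intros z Hz; apply Hk; lra.
  - rewrite Rmin_left, Rmax_right by lra; intros x Hx.
    apply (circle_integral_continuous k R0); [exact Hc|]; rewrite Rabs_pos_eq; lra.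
  - lra.
Qed.

(** Two shells meet at radius [r], and the inner one starts at radius [0], where the integral is
    [2 PI] times the central value. Only radii matter, so an exceptional point is excluded together
    with its whole circle. *)
Lemma min_principle (k : C -> C) (R0 r m : R) :
  1 < R0 -> 0 <= r <= 1 ->
  (forall z, Cmod z < R0 -> Ccontinuous k z) ->
  (forall z, 0 < Cmod z < 1 -> Cmod z <> r -> ex_Cderive k z) ->
  (forall z, Cmod z = 1 -> m <= Re (k z)) ->
  m <= Re (k 0).
Proof.
  intros HR Hr Hc Hk Hm; assert (Hpi := PI_RGT_0).
  assert (E : circle_integral k 1 = circle_integral k 0).
  { transitivity (circle_integral k r);
      apply (circle_integral_shell k R0); try lra; auto; intros z Hz; apply Hk; lra. }
  assert (E0 : circle_integral k 0 = 2 * PI * Re (k 0)).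
  { unfold circle_integral; rewrite (RInt_ext _ (fun _ => Re (k 0))).
    - rewrite RInt_const; unfold scal; simpl; unfold mult; simpl; ring.
    - intros t _; do 2 f_equal; unfold polar; rewrite !Rmult_0_l; reflexivity. }
  assert (B : 2 * PI * m <= circle_integral k 1).
  { unfold circle_integral.
    replace (2 * PI * m) with (RInt (fun _ => m) 0 (2 * PI))
      by (rewrite RInt_const; unfold scal; simpl; unfold mult; simpl; ring).
    apply RInt_le; [lra | apply ex_RInt_const | |].
    - apply ex_circle_integral; intros z Hz; apply Hc; rewrite Hz, Rabs_R1; exact HR.
    - intros t _; apply Hm; rewrite Cmod_polar, Rabs_R1; reflexivity. }
  rewrite E, E0 in B; apply Rmult_le_reg_l with (2 * PI); lra.
Qed.

(** * Complex derivatives and difference quotients *)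

Lemma is_Cderive_id (z : C) : is_Cderive (fun w => w) z (RtoC 1).
Proof. exact (@is_derive_id C_AbsRing z). Qed.

Lemma is_Cderive_const (c z : C) : is_Cderive (fun _ => c) z (RtoC 0).
Proof. exact (@is_derive_const C_AbsRing (AbsRing_NormedModule C_AbsRing) c z). Qed.

Lemma is_Cderive_minus (f g : C -> C) (z l m : C) :
  is_Cderive f z l -> is_Cderive g z m -> is_Cderive (fun w => (f w - g w)%C) z (l - m)%C.
Proof. exact (@is_derive_minus C_AbsRing (AbsRing_NormedModule C_AbsRing) f g z l m). Qed.

Lemma is_Cderive_plus (f g : C -> C) (z l m : C) :
  is_Cderive f z l -> is_Cderive g z m -> is_Cderive (fun w => (f w + g w)%C) z (l + m)%C.
Proof. exact (@is_derive_plus C_AbsRing (AbsRing_NormedModule C_AbsRing) f g z l m). Qed.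

Lemma is_Cderive_mult (f g : C -> C) (z l m : C) :
  is_Cderive f z l -> is_Cderive g z m ->
  is_Cderive (fun w => (f w * g w)%C) z (l * g z + f z * m)%C.
Proof.
  intros Hf Hg; exact (@is_derive_mult C_AbsRing f g z l m Hf Hg Cmult_comm).
Qed.

Lemma is_Cderive_comp (f g : C -> C) (z l m : C) :
  is_Cderive f (g z) l -> is_Cderive g z m -> is_Cderive (fun w => f (g w)) z (m * l)%C.
Proof.
  exact (@is_derive_comp C_AbsRing (AbsRing_NormedModule C_AbsRing) f g z l m).
Qed.

Lemma is_Cderive_Cinv (z : C) : z <> 0 -> is_Cderive Cinv z (- / (z * z))%C.
Proof.
  intros Hz; rewrite is_Cderive_iff; intros eps.
  assert (Hm : 0 < Cmod z) by (apply Cmod_gt_0, Hz).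
  set (m := Cmod z) in *.
  (* The remainder is [(w - z)^2 / (w z^2)]. The first bound gives [|w| >= m / 2]; the second then
     makes the factor beside [w - z] at most [eps]. *)
  assert (Hd : 0 < Rmin (m / 2) (eps * (m ^ 3 / 2))).
  { apply Rmin_pos; [lra|]; apply Rmult_lt_0_compat; [apply cond_pos|].
    apply Rdiv_lt_0_compat; [apply pow_lt, Hm|lra]. }
  exists (mkposreal _ Hd); cbn [pos]; intros w Hw.
  assert (E1 := Rmin_l (m / 2) (eps * (m ^ 3 / 2))).
  assert (E2 := Rmin_r (m / 2) (eps * (m ^ 3 / 2))).
  assert (Hwm : m / 2 <= Cmod w).
  { assert (T := Cmod_triangle w (- (w - z))); rewrite Cmod_opp in T.
    replace (w + - (w - z))%C with z in T by ring; fold m in T; lra. }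
  assert (Hw0 : w <> 0) by (apply Cmod_gt_0; lra).
  replace (/ w - / z - (w - z) * - / (z * z))%C with ((w - z) * ((w - z) / (w * (z * z))))%C
    by (field; auto).
  rewrite Cmod_mult, Rmult_comm; apply Rmult_le_compat_r; [apply Cmod_ge_0|].
  rewrite Cmod_div, !Cmod_mult by (repeat apply Cmult_neq_0; auto); fold m.
  assert (0 < m * m) by nra.
  apply Rle_div_l; [apply Rmult_lt_0_compat; lra|].
  apply Rle_trans with (eps * (m ^ 3 / 2)); [lra|].
  apply Rmult_le_compat_l; [apply Rlt_le, cond_pos|].
  replace (m ^ 3 / 2) with (m / 2 * (m * m)) by field.
  apply Rmult_le_compat_r; lra.
Qed.

Lemma is_Cderive_inv (f : C -> C) (z l : C) :
  is_Cderive f z l -> f z <> 0 -> is_Cderive (fun w => / f w)%C z (l * - / (f z * f z))%C.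
Proof. intros Hf Hz; apply (is_Cderive_comp Cinv f); [apply is_Cderive_Cinv|]; auto. Qed.

Lemma ex_Cderive_continuous (f : C -> C) (z : C) : ex_Cderive f z -> Ccontinuous f z.
Proof. exact (@ex_derive_continuous C_AbsRing (AbsRing_NormedModule C_AbsRing) f z). Qed.

Lemma Ccontinuous_plus (f g : C -> C) (z : C) :
  Ccontinuous f z -> Ccontinuous g z -> Ccontinuous (fun w => (f w + g w)%C) z.
Proof.
  exact (@continuous_plus (AbsRing_UniformSpace C_AbsRing) C_AbsRing (AbsRing_NormedModule C_AbsRing) f g z).
Qed.

Lemma Ccontinuous_mult (f g : C -> C) (z : C) :
  Ccontinuous f z -> Ccontinuous g z -> Ccontinuous (fun w => (f w * g w)%C) z.
Proof. exact (@continuous_mult (AbsRing_UniformSpace C_AbsRing) C_AbsRing f g z). Qed.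

(** With [l] the derivative at [w], the singularity of the quotient is filled in continuously, which
    is all that [min_principle] asks at the centre. *)
Definition Cslope (p : C -> C) (w l z : C) : C :=
  if Ceq_dec z w then l else ((p z - p w) / (z - w))%C.

Lemma Cslope_neq (p : C -> C) (w l z : C) :
  z <> w -> Cslope p w l z = ((p z - p w) / (z - w))%C.
Proof. unfold Cslope; destruct (Ceq_dec z w); tauto. Qed.

Lemma Cslope_eq (p : C -> C) (w l : C) : Cslope p w l w = l.
Proof. unfold Cslope; destruct (Ceq_dec w w); tauto. Qed.

Lemma Cminus_neq_0 (z w : C) : z <> w -> (z - w)%C <> 0.
Proof. intros H E; apply H; replace z with (z - w + w)%C by ring; rewrite E; ring. Qed.

Lemma ex_Cderive_Cslope (p : C -> C) (w l z : C) :
  z <> w -> ex_Cderive p z -> ex_Cderive (Cslope p w l) z.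
Proof.
  intros Hz [dp Hp].
  assert (Hd : 0 < Cmod (z - w)) by (apply Cmod_gt_0, Cminus_neq_0, Hz).
  eexists; apply (@is_derive_ext_loc C_AbsRing (AbsRing_NormedModule C_AbsRing)
    (fun y => (p y - p w) * / (y - w))%C).
  - exists (mkposreal _ Hd); intros y Hy; change (Cmod (y - z) < Cmod (z - w)) in Hy.
    symmetry; apply Cslope_neq; intros ->.
    rewrite <- (Cmod_opp (z - w)) in Hy; replace (- (z - w))%C with (w - z)%C in Hy by ring; lra.
  - apply is_Cderive_mult.
    + apply is_Cderive_minus; [exact Hp | apply is_Cderive_const].
    + apply is_Cderive_inv; [|apply Cminus_neq_0, Hz].
      apply is_Cderive_minus; [apply is_Cderive_id | apply is_Cderive_const].
Qed.

Lemma Ccontinuous_Cslope (p : C -> C) (w l z : C) :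
  is_Cderive p w l -> ex_Cderive p z -> Ccontinuous (Cslope p w l) z.
Proof.
  intros Hw Hz; destruct (Ceq_dec z w) as [->|n];
    [|apply ex_Cderive_continuous, ex_Cderive_Cslope; auto].
  rewrite is_Cderive_iff in Hw; rewrite Ccontinuous_iff; intros eps.
  assert (E2 : 0 < eps / 2) by (generalize (cond_pos eps); lra).
  destruct (Hw (mkposreal _ E2)) as [d Hd]; cbn [pos] in Hd; exists d; intros y Hy.
  rewrite Cslope_eq; destruct (Ceq_dec y w) as [->|n].
  - rewrite Cslope_eq; replace (l - l)%C with (RtoC 0) by ring.
    rewrite Cmod_0; apply cond_pos.
  - rewrite Cslope_neq by exact n; assert (n' := Cminus_neq_0 _ _ n).
    replace ((p y - p w) / (y - w) - l)%C with ((p y - p w - (y - w) * l) / (y - w))%C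
      by (field; exact n').
    rewrite Cmod_div by exact n'.
    apply Rle_lt_trans with (eps / 2); [|lra].
    apply Rle_div_l; [apply Cmod_gt_0, n' | apply Hd, Hy].
Qed.

(** * The Harnack and Lindelof inequalities *)

(* On the unit circle [(z - r) (1 - r z) = z |1 - r z|^2]. *)
Lemma circle_kernel (r x y : R) :
  0 < r < 1 -> x ^ 2 + y ^ 2 = 1 ->
  let D := 1 - 2 * r * x + r ^ 2 in
  let z : C := (x, y) in
  0 < D /\
  (/ z)%C = Cconj z /\
  z <> r /\
  (z * / (1 - r * z) / (z - r))%C = RtoC (/ D) /\
  Re ((1 + r * z) * / (1 - r * z))%C = (1 - r ^ 2) / D.
Proof.
  intros Hr Hxy D z.
  assert (HD : 0 < D).
  { assert (x <= 1) by nra; unfold D.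
    replace (1 - 2 * r * x + r ^ 2) with ((1 - r) ^ 2 + 2 * (r * (1 - x))) by ring.
    assert (0 < (1 - r) ^ 2) by (apply pow_lt; lra); nra. }
  assert (Hyy : y ^ 2 = 1 - x ^ 2) by lra.
  assert (Hzz : (z * Cconj z = 1)%C).
  { apply injective_projections; simpl; [rewrite <- Hxy|]; ring. }
  assert (Hz : z <> 0).
  { intros E; rewrite E, Cmult_0_l in Hzz; injection Hzz; lra. }
  assert (Hprod : ((z - r) * (1 - r * z) = z * RtoC D)%C).
  { unfold D, z; apply injective_projections; simpl; ring [Hyy]. }
  assert (HDC : RtoC D <> 0) by (intros E; injection E; lra).
  assert (H1 : (z - r)%C <> 0).
  { intros E; rewrite E, Cmult_0_l in Hprod; symmetry in Hprod.
    revert Hprod; apply Cmult_neq_0; auto. }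
  assert (H2 : (1 - r * z)%C <> 0).
  { intros E; rewrite E, Cmult_0_r in Hprod; symmetry in Hprod.
    revert Hprod; apply Cmult_neq_0; auto. }
  split; [exact HD|]; split; [|split; [|split]].
  - replace (/ z)%C with (/ z * (z * Cconj z))%C by (rewrite Hzz; ring).
    field; exact Hz.
  - intros E; apply H1; rewrite E; ring.
  - replace (z * / (1 - r * z) / (z - r))%C with (z / ((z - r) * (1 - r * z)))%C
      by (field; auto).
    rewrite Hprod, RtoC_inv by lra; field; auto.
  - replace (1 + r * z)%C with (1 + r * x, r * y) by
      (unfold z; apply injective_projections; simpl; ring).
    replace (1 - r * z)%C with (1 - r * x, - (r * y)) by
      (unfold z; apply injective_projections; simpl; ring).
    unfold Re, Cinv, Cmult; cbn [fst snd].
    replace ((1 - r * x) ^ 2 + (- (r * y)) ^ 2) with D by (unfold D; ring [Hyy]).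
    replace (1 - r ^ 2) with ((1 + r * x) * (1 - r * x) - (r * y) * (r * y)) by ring [Hyy].
    field; lra.
Qed.

Lemma Cmod_lt_inv_neq_0 (r R0 : R) (z : C) :
  0 < r -> R0 <= / r -> Cmod z < R0 -> (1 - r * z)%C <> 0.
Proof.
  intros Hr HR Hz E.
  assert (E1 : Cmod (r * z) = 1).
  { replace (r * z)%C with (1 - (1 - r * z))%C by ring; rewrite E.
    replace (1 - 0)%C with (RtoC 1) by ring; apply Cmod_1. }
  rewrite Cmod_mult, Cmod_R, Rabs_pos_eq in E1 by lra.
  assert (r * Cmod z < r * / r) by (apply Rmult_lt_compat_l; lra).
  rewrite Rinv_r in H; lra.
Qed.

(* Harnack's inequality, sharpened by the first Taylor coefficient. The test function [k]
   is [p] times [1 + r^2 + r (z + 1/z) - (1 - r^2)^2 / |1 - r z|^2 >= 0] on the unit circle,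
   with the poles at [0] and [r] subtracted off. *)
Lemma harnack_first_coefficient (p : C -> C) (R1 r : R) (dp : C) :
  1 < R1 -> 0 < r < 1 ->
  (forall z, Cmod z < R1 -> ex_Cderive p z) ->
  (forall z, Cmod z < R1 -> 1 / 2 <= Re (p z)) ->
  p 0 = 1 -> is_Cderive p (RtoC 0) dp ->
  (1 - r ^ 2) * Re (p r) <= 1 + r * Re dp.
Proof.
  intros HR1 Hr Hp Hre Hp0 Hdp.
  assert (Cr : Cmod r = r) by (rewrite Cmod_R, Rabs_pos_eq; lra).
  destruct (Hp r ltac:(rewrite Cr; lra)) as [dr Hdr].
  (* On the unit circle the two slopes below become [(p z - 1) / z] and, with its factor,
     [(p z - p r) / |1 - r z|^2]. The last term of [k] has a multiple of the Poisson kernel as real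
     part; [c0] is chosen so that [Re (p r)] drops out there and [Re (p z) - 1/2] is what multiplies
     the kernel. *)
  set (c0 := Re (p r) - 1 / 2).
  set (k := fun z : C => ((RtoC (1 + r ^ 2) * p z + (r * z) * p z)
    + (r * Cslope p 0 dp z
    + (RtoC (- (1 - r ^ 2) ^ 2) * (Cslope p r dr z * (z * / (1 - r * z)))
    + RtoC (- c0 * (1 - r ^ 2)) * ((1 + r * z) * / (1 - r * z)))))%C).
  assert (Hr1 : 1 < / r) by (rewrite <- Rinv_1; apply Rinv_lt_contravar; lra).
  (* This radius stays within the domain of [p] and avoids the pole [1 / r], yet exceeds [1]. *)
  set (R0 := Rmin R1 (/ r)).
  assert (HR0 : 1 < R0) by (apply Rmin_glb_lt; auto).
  assert (L1 := Rmin_l R1 (/ r)); assert (L2 := Rmin_r R1 (/ r)); fold R0 in L1, L2.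
  assert (Hnz : forall z, Cmod z < R0 -> (1 - r * z)%C <> 0)
    by (intros z Hz; apply (Cmod_lt_inv_neq_0 r R0); auto; lra).
  assert (Dlin : forall z, is_Cderive (fun w => r * w)%C z (RtoC 0 * z + r * RtoC 1)%C).
  { intros z; apply is_Cderive_mult; [apply is_Cderive_const | apply is_Cderive_id]. }
  assert (Dinv : forall z, Cmod z < R0 -> ex_Cderive (fun w => / (1 - r * w))%C z).
  { intros z Hz; eexists; apply is_Cderive_inv; [|apply Hnz, Hz].
    apply is_Cderive_minus; [apply is_Cderive_const | apply Dlin]. }
  assert (D1 : forall z, Cmod z < R0 -> ex_Cderive (fun w => w * / (1 - r * w))%C z).
  { intros z Hz; destruct (Dinv z Hz) as [l Hl]; eexists.
    apply is_Cderive_mult; [apply is_Cderive_id | exact Hl]. }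
  assert (D2 : forall z, Cmod z < R0 ->
    ex_Cderive (fun w => RtoC (- c0 * (1 - r ^ 2)) * ((1 + r * w) * / (1 - r * w)))%C z).
  { intros z Hz; destruct (Dinv z Hz) as [l Hl]; eexists.
    apply is_Cderive_mult; [apply is_Cderive_const|].
    apply is_Cderive_mult; [|exact Hl].
    apply is_Cderive_plus; [apply is_Cderive_const | apply Dlin]. }
  assert (D3 : forall z, Cmod z < R0 ->
    ex_Cderive (fun w => RtoC (1 + r ^ 2) * p w + (r * w) * p w)%C z).
  { intros z Hz; destruct (Hp z ltac:(lra)) as [l Hl]; eexists.
    apply is_Cderive_plus; (apply is_Cderive_mult; [|exact Hl]);
      [apply is_Cderive_const | apply Dlin]. }
  assert (Hk0 : Re (k 0) = 1 + r ^ 2 + r * Re dp - c0 * (1 - r ^ 2)).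
  { unfold k; rewrite Hp0, Cslope_eq.
    replace (1 - r * 0)%C with (RtoC 1) by ring.
    replace (RtoC (1 + r ^ 2) * 1 + r * 0 * 1 + (r * dp +
      (RtoC (- (1 - r ^ 2) ^ 2) * (Cslope p r dr 0 * (0 * / 1)) +
       RtoC (- c0 * (1 - r ^ 2)) * ((1 + r * 0) * / 1))))%C
      with (RtoC (1 + r ^ 2) + (r * dp + RtoC (- c0 * (1 - r ^ 2))))%C by field.
    rewrite !re_plus, re_scal_l, !re_RtoC; ring. }
  (* On the circle [Re k] equals [(1 + r^2) / 2] plus [Re p - 1/2] times the nonnegative weight. *)
  assert (Hmin : (1 + r ^ 2) / 2 <= Re (k 0)).
  { apply (min_principle k R0 r); [exact HR0 | lra | | |].
    - intros z Hz; unfold k.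
      apply Ccontinuous_plus; [apply ex_Cderive_continuous, D3, Hz|].
      apply Ccontinuous_plus; [|apply Ccontinuous_plus].
      + apply Ccontinuous_mult; [apply continuous_const|].
        apply Ccontinuous_Cslope; [exact Hdp | apply Hp; lra].
      + apply Ccontinuous_mult; [apply continuous_const|].
        apply Ccontinuous_mult; [|apply ex_Cderive_continuous, D1, Hz].
        apply Ccontinuous_Cslope; [exact Hdr | apply Hp; lra].
      + apply ex_Cderive_continuous, D2, Hz.
    - intros z Hz Hzr.
      assert (n0 : z <> 0) by (apply Cmod_gt_0; lra).
      assert (nr : z <> r) by (intros E; apply Hzr; rewrite E; exact Cr).
      destruct (D3 z ltac:(lra)) as [l3 H3].
      destruct (ex_Cderive_Cslope p 0 dp z n0 (Hp z ltac:(lra))) as [l0 H0].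
      destruct (ex_Cderive_Cslope p r dr z nr (Hp z ltac:(lra))) as [l4 H4].
      destruct (D1 z ltac:(lra)) as [l1 H1]; destruct (D2 z ltac:(lra)) as [l2 H2].
      eexists; unfold k.
      apply is_Cderive_plus; [exact H3|].
      apply is_Cderive_plus;
        [apply is_Cderive_mult; [apply is_Cderive_const | exact H0]|].
      apply is_Cderive_plus; [|exact H2].
      apply is_Cderive_mult; [apply is_Cderive_const|].
      apply is_Cderive_mult; [exact H4 | exact H1].
    - intros z Hz.
      assert (Hu := Hre z ltac:(lra)).
      assert (n0 : z <> 0) by (apply Cmod_gt_0; lra).
      assert (Hxy : Re z ^ 2 + Im z ^ 2 = 1) by (rewrite <- Cmod2_alt, Hz; ring).
      destruct z as [x y]; simpl Re in Hxy; simpl Im in Hxy.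
      destruct (circle_kernel r x y Hr Hxy) as (HD & Hinv & nr & Hker & Hpois).
      set (D := 1 - 2 * r * x + r ^ 2) in *.
      set (z := (x, y) : C) in *.
      unfold k; rewrite !Cslope_neq by auto.
      rewrite Hp0.
      replace ((p z - 1) / (z - 0))%C with ((p z - 1) * Cconj z)%C
        by (rewrite <- Hinv; field; exact n0).
      replace ((p z - p r) / (z - r) * (z * / (1 - r * z)))%C
        with ((p z - p r) * (z * / (1 - r * z) / (z - r)))%C
        by (unfold Cdiv; ring).
      rewrite Hker, !re_plus, !re_scal_l, Hpois, re_scal_r.
      unfold Cminus; rewrite !re_plus, !re_opp.
      replace (Re (r * z * p z)%C) with (r * (x * Re (p z) - y * Im (p z)))
        by (unfold z, Re, Im; simpl; ring).
      replace (Re ((p z + - (1)) * Cconj z)%C)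
        with ((Re (p z) - 1) * x + Im (p z) * y)
        by (unfold z, Re, Im; simpl; ring).
      set (u := Re (p z)) in *; set (v := Im (p z)); clearbody u v.
      (* This is [D (1 + r^2 + 2 r x) = (1 + r^2)^2 - 4 r^2 x^2] combined with [x^2 = 1 - y^2]; it
         exhibits the weight as [(2 r y)^2 / D]. *)
      assert (T : (1 - r ^ 2) ^ 2 / D = 1 + r ^ 2 + 2 * r * x - 4 * (r * y) ^ 2 / D).
      { assert (Hyy : y ^ 2 = 1 - x ^ 2) by lra.
        apply Rmult_eq_reg_r with D; [|lra].
        unfold Rdiv; rewrite Rmult_minus_distr_r, !Rmult_assoc, Rinv_l by lra.
        unfold D; ring [Hyy]. }
      assert (Tpos : 0 <= (u - 1 / 2) * (4 * (r * y) ^ 2 / D)).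
      { apply Rmult_le_pos; [lra|]; apply Rdiv_le_0_compat; [|exact HD].
        generalize (pow2_ge_0 (r * y)); lra. }
      replace (- (1 - r ^ 2) ^ 2 * ((u + - Re (p r)) * / D)
        + - c0 * (1 - r ^ 2) * ((1 - r ^ 2) / D))
        with (- (u - 1 / 2) * ((1 - r ^ 2) ^ 2 / D)) by (unfold c0; field; lra).
      rewrite T; lra. }
  rewrite Hk0 in Hmin; unfold c0 in Hmin; lra.
Qed.

(** The excess over [1/2] is [(1 - |w|^2) / (2 |1 - w|^2)]. *)
Lemma re_Cinv_disc (w : C) : Cmod w < 1 -> 1 / 2 <= Re (/ (1 - w))%C.
Proof.
  intros Hw; assert (H2 := Cmod2_alt w); assert (H0 := Cmod_ge_0 w).
  destruct w as [x y]; simpl Re in H2; simpl Im in H2.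
  assert (Hxy : x ^ 2 + y ^ 2 < 1) by (rewrite <- H2; simpl; nra).
  replace (1 - (x, y))%C with (1 - x, - y) by (apply injective_projections; simpl; ring).
  unfold Re, Cinv; cbn [fst snd].
  assert (x < 1) by nra.
  assert (0 < (1 - x) ^ 2) by (apply pow_lt; lra).
  assert (HN : 0 < (1 - x) ^ 2 + (- y) ^ 2) by (generalize (pow2_ge_0 (- y)); lra).
  apply (proj1 (Rle_div_r (1 / 2) _ _ HN)); lra.
Qed.

Lemma ex_unit_rotation (w : C) : exists c : C, Cmod c = 1 /\ (c * w)%C = Cmod w.
Proof.
  destruct (Ceq_dec w 0) as [->|n].
  - exists 1; rewrite Cmod_1, Cmod_0; split; [reflexivity|ring].
  - assert (Hm : 0 < Cmod w) by (apply Cmod_gt_0, n).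
    exists (Cmod w / w)%C; split; [|field; exact n].
    rewrite Cmod_div, Cmod_R, Rabs_pos_eq by (auto; lra); field; lra.
Qed.

(** After the rotation, [p(r)] is the real number [1 / (1 - |F(r)|)]. Since [F] vanishes at [0],
    [p'(0) = c d], whose real part is at most [|d|]. *)
Lemma lindelof (F : C -> C) (R1 r : R) (d : C) :
  1 < R1 -> 0 < r < 1 ->
  (forall z, Cmod z < R1 -> ex_Cderive F z) ->
  (forall z, Cmod z < R1 -> Cmod (F z) < 1) ->
  F 0 = 0 -> is_Cderive F (RtoC 0) d ->
  1 - r ^ 2 <= (1 - Cmod (F r)) * (1 + r * Cmod d).
Proof.
  intros HR Hr Hd Hlt H0 Hd0.
  destruct (ex_unit_rotation (F r)) as (c & Hc & HcF).
  assert (Hsmall : forall z, Cmod z < R1 -> Cmod (c * F z) < 1)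
    by (intros z Hz; rewrite Cmod_mult, Hc, Rmult_1_l; apply Hlt, Hz).
  assert (Hnz : forall z, Cmod z < R1 -> (1 - c * F z)%C <> 0).
  { intros z Hz E; assert (S := Hsmall z Hz).
    replace (c * F z)%C with (1 - (1 - c * F z))%C in S by ring.
    rewrite E in S; replace (1 - 0)%C with (RtoC 1) in S by ring.
    rewrite Cmod_1 in S; lra. }
  assert (Hder : forall z l, Cmod z < R1 -> is_Cderive F z l ->
    is_Cderive (fun w => / (1 - c * F w))%C z
      ((0 - (0 * F z + c * l)) * - / ((1 - c * F z) * (1 - c * F z)))%C).
  { intros z l Hz Hl; apply (is_Cderive_inv (fun w => 1 - c * F w)%C); [|apply Hnz, Hz].
    apply (is_Cderive_minus (fun _ => RtoC 1) (fun w => c * F w)%C); [apply is_Cderive_const|].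
    apply (is_Cderive_mult (fun _ => c) F); [apply is_Cderive_const | exact Hl]. }
  assert (H := harnack_first_coefficient (fun w => / (1 - c * F w))%C R1 r (c * d)%C HR Hr).
  cbv beta in H; rewrite HcF in H.
  assert (Hm : Cmod (F r) < 1) by (apply Hlt; rewrite Cmod_R, Rabs_pos_eq; lra).
  replace (/ (1 - Cmod (F r)))%C with (RtoC (/ (1 - Cmod (F r)))) in H
    by (rewrite RtoC_inv by lra; rewrite RtoC_minus; reflexivity).
  rewrite re_RtoC in H.
  assert (Hre : Re (c * d)%C <= Cmod d).
  { eapply Rle_trans; [apply Rle_abs|]; eapply Rle_trans; [apply re_le_Cmod|].
    rewrite Cmod_mult, Hc; lra. }
  assert (H' : (1 - r ^ 2) * / (1 - Cmod (F r)) <= 1 + r * Cmod d).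
  { eapply Rle_trans; [apply H|].
    - intros z Hz; destruct (Hd z Hz) as [l Hl]; eexists; apply Hder; eassumption.
    - intros z Hz; apply re_Cinv_disc, Hsmall, Hz.
    - rewrite H0; replace (1 - c * 0)%C with (RtoC 1) by ring; field.
    - assert (E := Hder 0 d ltac:(rewrite Cmod_0; lra) Hd0); rewrite H0 in E.
      replace (1 - c * 0)%C with (RtoC 1) in E by ring.
      replace (c * d)%C with ((0 - (0 * 0 + c * d)) * - / (1 * 1))%C by field.
      exact E.
    - apply Rplus_le_compat_l, Rmult_le_compat_l; lra. }
  apply Rmult_le_compat_r with (r := 1 - Cmod (F r)) in H'; [|lra].
  rewrite Rmult_assoc, Rinv_l in H' by lra; lra.
Qed.

(** * Approach to the boundary point along the radius *)

(** The function [f(rho b z)] is analytic for [|z| < 1 / rho], hence past the unit circle, and the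
    factor [b] turns the radius towards [b] into the real one. Its derivative at [0] has modulus
    [rho |d|], and [r rho <= 1] removes both factors. *)
Lemma lindelof_dilated (f : C -> C) (b d : C) (r rho : R) :
  (forall z, Cmod z < 1 -> ex_Cderive f z) ->
  (forall z, Cmod z < 1 -> Cmod (f z) < 1) ->
  f 0 = 0 -> is_Cderive f (RtoC 0) d -> Cmod b = 1 -> 0 < r < 1 -> 0 < rho < 1 ->
  1 - r ^ 2 <= (1 - Cmod (f (RtoC (rho * r) * b)%C)) * (1 + Cmod d).
Proof.
  intros Hf Hlt H0 Hd Hb Hr Hrho.
  assert (Hcr : Cmod (rho * b) = rho)
    by (rewrite Cmod_mult, Hb, Cmod_R, Rabs_pos_eq; lra).
  assert (Hin : forall z, Cmod z < / rho -> Cmod (rho * b * z) < 1).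
  { intros z Hz; rewrite Cmod_mult, Hcr.
    apply Rmult_lt_compat_l with (r := rho) in Hz; [|lra]; rewrite Rinv_r in Hz; lra. }
  assert (Hder : forall z l, is_Cderive f (rho * b * z)%C l ->
    is_Cderive (fun w => f (rho * b * w)%C) z ((0 * z + rho * b * 1) * l)%C).
  { intros z l Hl; apply (is_Cderive_comp f (fun w => rho * b * w)%C); [exact Hl|].
    apply (is_Cderive_mult (fun _ => rho * b)%C (fun w => w));
      [apply is_Cderive_const | apply is_Cderive_id]. }
  assert (HR : 1 < / rho) by (rewrite <- Rinv_1; apply Rinv_lt_contravar; lra).
  assert (L := lindelof (fun w => f (rho * b * w)%C) (/ rho) r
    ((0 * 0 + rho * b * 1) * d)%C HR Hr).
  cbv beta in L.
  replace (0 * 0 + rho * b * 1)%C with (rho * b)%C in L by ring.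
  rewrite Cmod_mult, Hcr in L.
  replace (rho * b * r)%C with (RtoC (rho * r) * b)%C in L by (rewrite RtoC_mult; ring).
  assert (Hm : Cmod (f (RtoC (rho * r) * b)%C) < 1).
  { apply Hlt; rewrite Cmod_mult, Hb, Cmod_R, Rabs_pos_eq; nra. }
  eapply Rle_trans; [apply L|].
  - intros z Hz; destruct (Hf _ (Hin z Hz)) as [l Hl]; eexists; apply Hder, Hl.
  - intros z Hz; apply Hlt, Hin, Hz.
  - rewrite Cmult_0_r; exact H0.
  - replace (rho * b * d)%C with ((0 * 0 + rho * b * 1) * d)%C by ring.
    apply Hder; rewrite Cmult_0_r; exact Hd.
  - apply Rmult_le_compat_l; [lra|]; apply Rplus_le_compat_l.
    assert (Hd0 := Cmod_ge_0 d); assert (r * rho <= 1) by nra.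
    rewrite <- Rmult_assoc; nra.
Qed.

(** Both module structures have norm [Cmod], so the same remainder estimate serves. *)
Lemma is_derive_C_NormedModule (f : C -> C) (z l : C) :
  @is_derive C_AbsRing C_NormedModule f z l -> is_Cderive f z l.
Proof.
  intros [_ H]; apply is_Cderive_iff; intros eps.
  exact (H z (fun P HP => HP) eps).
Qed.

Theorem lemma1 (f : C -> C)
  (f_analytic : analytic_in unit_disc f)
  (f_lt1 : forall z : C, Cmod z < 1 -> Cmod (f z) < 1)
  (f_at0 : f (RtoC 0) = RtoC 0)
  (b fb db : C)
  (b_unit : Cmod b = 1)
  (f_extends : extends_continuously_to f b fb)
  (fb_unit : Cmod fb = 1)
  (f_deriv : is_boundary_derivative f b fb db) :
  Cmod db >= 2 / (1 + Cmod (C_derive f (RtoC 0))).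
Proof.
  assert (Hder : is_Cderive f (RtoC 0) (C_derive f (RtoC 0))).
  { apply is_derive_C_NormedModule, (C_derive_correct f (RtoC 0) (RtoC 0)), f_analytic.
    unfold unit_disc; rewrite Cmod_0; lra. }
  assert (f_ex : forall z, Cmod z < 1 -> ex_Cderive f z).
  { intros z Hz; destruct (f_analytic z Hz) as [l Hl]; exists l.
    apply is_derive_C_NormedModule, Hl. }
  set (a := Cmod (C_derive f (RtoC 0))).
  assert (Ha : 0 <= a) by apply Cmod_ge_0.
  apply Rle_ge, Rnot_lt_le; intros Hlt.
  (* Half of the supposed gap is spent on the error of the difference quotient; the other half
     yields the contradiction. *)
  set (gap := 2 / (1 + a) - Cmod db).
  assert (Hgap : 0 < gap / 2) by (unfold gap; lra).
  assert (Hnear : locally (T := C_UniformSpace) db (fun y => Cmod (y - db) < gap / 2)).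
  { apply locally_C; exists (mkposreal _ Hgap); intros y Hy; exact Hy. }
  apply f_deriv, locally_C in Hnear; destruct Hnear as [delta Hdelta].
  (* Here [t] is [1 - r]. The bound [delta / 3] ensures [t (1 + t) < delta], and the last one gives
     [gap (1 + a) / 2 >= 6 t], the source of [6] in [S4]. *)
  set (t := Rmin (1 / 2) (Rmin (delta / 3) ((1 + a) * gap / 12))).
  assert (Ht : 0 < t).
  { repeat apply Rmin_pos; [lra | generalize (cond_pos delta); lra | nra]. }
  assert (T1 : t <= 1 / 2) by apply Rmin_l.
  assert (T2 : t <= delta / 3) by (eapply Rle_trans; [apply Rmin_r | apply Rmin_l]).
  assert (T3 : t <= (1 + a) * gap / 12) by (eapply Rle_trans; [apply Rmin_r | apply Rmin_r]).
  set (x := (1 - t ^ 2) * (1 - t)).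
  assert (Ht2 : 0 < t ^ 2 < 1) by (simpl; nra).
  assert (Hx : 0 < x < 1) by (unfold x; nra).
  assert (L := lindelof_dilated f b (C_derive f (RtoC 0)) (1 - t) (1 - t ^ 2)
    f_ex f_lt1 f_at0 Hder b_unit ltac:(lra) ltac:(lra)).
  fold a in L; fold x in L; set (z := (RtoC x * b)%C) in *.
  assert (Hzb : Cmod (z - b) = 1 - x).
  { replace (z - b)%C with (RtoC (x - 1) * b)%C by (unfold z; rewrite RtoC_minus; ring).
    rewrite Cmod_mult, b_unit, Cmod_R, Rabs_left; lra. }
  assert (Hx1 : 1 - x <= t * (1 + t)) by (unfold x; nra).
  assert (Hz1 : Cmod z < 1).
  { unfold z; rewrite Cmod_mult, b_unit, Cmod_R, Rabs_pos_eq; lra. }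
  assert (Hq := Hdelta z).
  unfold AbsRing_ball in Hq.
  assert (Hzd : Cmod (z - b) < delta) by (rewrite Hzb; nra).
  specialize (Hq Hzd Hz1); cbv beta in Hq.
  assert (Hnz : (z - b)%C <> 0) by (apply Cmod_gt_0; lra).
  assert (Q1 : Cmod ((f z - fb) / (z - b)) < Cmod db + gap / 2).
  { replace ((f z - fb) / (z - b))%C with ((f z - fb) / (z - b) - db + db)%C by ring.
    eapply Rle_lt_trans; [apply Cmod_triangle|]; lra. }
  rewrite Cmod_div, Hzb in Q1 by exact Hnz.
  apply Rlt_div_l in Q1; [|lra].
  (* Here [|f(b)| = 1] enters, as [1 - |f z| = |fb| - |f z|]. *)
  assert (Q2 : 1 - Cmod (f z) <= Cmod (f z - fb)).
  { assert (T := Cmod_triangle (f z) (- (f z - fb))); rewrite Cmod_opp in T.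
    replace (f z + - (f z - fb))%C with fb in T by ring; lra. }
  assert (Hg : Cmod db + gap / 2 = 2 / (1 + a) - gap / 2) by (unfold gap; lra).
  assert (Hg' : (2 / (1 + a) - gap / 2) * (1 + a) = 2 - gap * (1 + a) / 2) by (field; lra).
  assert (S1 : 1 - (1 - t) ^ 2 < (2 - gap * (1 + a) / 2) * (1 - x)).
  { rewrite <- Hg', <- Hg.
    eapply Rle_lt_trans; [exact L|].
    replace ((Cmod db + gap / 2) * (1 + a) * (1 - x))
      with ((Cmod db + gap / 2) * (1 - x) * (1 + a)) by ring.
    apply Rmult_lt_compat_r; lra. }
  assert (S2 : 0 <= Cmod db + gap / 2) by (generalize (Cmod_ge_0 db); lra).
  assert (S3 : 0 <= 2 - gap * (1 + a) / 2) by (rewrite <- Hg', <- Hg; nra).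
  (* Divided by [t > 0], this reads [2 - t < 2 - 4 t - 6 t^2], which is absurd. *)
  assert (S4 : t * (2 - t) < (2 - 6 * t) * (t * (1 + t))).
  { apply Rle_lt_trans with (1 - (1 - t) ^ 2); [right; ring|].
    eapply Rlt_le_trans; [exact S1|].
    apply Rle_trans with ((2 - gap * (1 + a) / 2) * (t * (1 + t))).
    - apply Rmult_le_compat_l; lra.
    - apply Rmult_le_compat_r; [nra|lra]. }
  nra.
Qed.
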